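(* Let $p,q,r$ be integers with $2\le r\le\min(p,q)$. On the space $\Delta_{pq-1}$ of $p\times q$ contingency tables of probabilities, consider the null hypothesis $\mathcal{P}_0=\{\boldsymbol\pi\in\Delta_{pq-1}:\boldsymbol\pi\text{ has rank less than } r\}$. The NTUB and SUB unbiasedness thresholds of $\mathcal{P}_0$ are both equal to $2r$. Moreover, when $n=2r$ and $\alpha\in(0,1)$, for some $c>0$ the polynomial $$\beta(\boldsymbol\pi)=c\sum_{I,J}\det(\boldsymbol\pi_{I,J})^2+\alpha$$ is the power function of an SUB test of $\mathcal{P}_0$, where the sum is over index sets $I\subseteq\{1,\dots,p\}$, $J\subseteq\{1,\dots,q\}$ of size $r$ and $\boldsymbol\pi_{I,J}$ is the corresponding $r\times r$ submatrix of $\boldsymbol\pi$.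
   Context: $\Delta_{pq-1}$ is the set of $p\times q$ real matrices $\boldsymbol\pi=(\pi_{ij})$ with non-negative entries summing to one, i.e. the probability simplex with $k=pq$ categories. Data: $\mathbf X\sim\text{Multinomial}_{k}(\boldsymbol\pi,n)$, $n$ the sample size. The alternative is $\mathcal{P}_A=\Delta_{pq-1}\setminus\mathcal{P}_0$. A (randomized) test for sample size $n$ is a function $\phi:\{\mathbf x\in\mathbb{N}^{p\times q}:\sum_{i,j} x_{ij}=n\}\to[0,1]$, with power function $\beta_\phi(\boldsymbol\pi)=\sum_{\mathbf x}\phi(\mathbf x)\frac{n!}{\prod_{i,j}x_{ij}!}\prod_{i,j}\pi_{ij}^{x_{ij}}$ on $\Delta_{pq-1}$. $\phi$ is unbiased if $\beta_\phi(\boldsymbol\pi_0)\le\beta_\phi(\boldsymbol\pi_A)$ for all $\boldsymbol\pi_0\in\mathcal{P}_0,\boldsymbol\pi_A\in\mathcal{P}_A$; NTUB (non-trivial unbiased) if unbiased with $\beta_\phi$ non-constant; SUB (strictly unbiased) if the inequality is strict for all such pairs. The NTUB (SUB) unbiasedness threshold is the minimum sample size $n$ for which an NTUB (SUB) test exists. *)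

(* Defs.v *)
From mathcomp Require Import all_boot all_order all_algebra.
From mathcomp Require Import all_classical all_reals.

Set Implicit Arguments.
Unset Strict Implicit.
Unset Printing Implicit Defensive.

Import Order.TTheory GRing.Theory Num.Theory.

Local Open Scope classical_set_scope.
Local Open Scope ring_scope.

(* Entries of a table of natural numbers with total n are at most n, so
   ordinals below n.+1 lose nothing and make the sample space a finType. *)
Definition count_table (p q n : nat) : Type :=
  {x : 'M['I_n.+1]_(p, q) | (\sum_i \sum_j (x i j : nat))%N == n}.

Definition simplex (R : realType) (p q : nat) : set 'M[R]_(p, q) :=
  [set pi | (forall i j, 0 <= pi i j) /\ \sum_i \sum_j pi i j = 1].

Definition multinomial_pmf (R : realType) (p q n : nat) (pi : 'M[R]_(p, q))
    (x : count_table p q n) : R :=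
  (n`!)%:R / (\prod_i \prod_j (val x i j)`!)%N%:R
  * \prod_i \prod_j pi i j ^+ val x i j.

Definition is_test (R : realType) (p q n : nat)
    (phi : count_table p q n -> R) : Prop :=
  forall x, 0 <= phi x <= 1.

Definition power_fun (R : realType) (p q n : nat)
    (phi : count_table p q n -> R) (pi : 'M[R]_(p, q)) : R :=
  \sum_x phi x * multinomial_pmf pi x.

Definition alternative (R : realType) (p q : nat)
    (P0 : set 'M[R]_(p, q)) : set 'M[R]_(p, q) :=
  @simplex R p q `\` P0.

Definition unbiased (R : realType) (p q n : nat) (P0 : set 'M[R]_(p, q))
    (phi : count_table p q n -> R) : Prop :=
  forall pi0 piA, P0 pi0 -> alternative P0 piA ->
    power_fun phi pi0 <= power_fun phi piA.

Definition NTUB (R : realType) (p q n : nat) (P0 : set 'M[R]_(p, q))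
    (phi : count_table p q n -> R) : Prop :=
  unbiased P0 phi /\
  exists pi1 pi2, [/\ simplex pi1, simplex pi2 &
    power_fun phi pi1 <> power_fun phi pi2].

Definition SUB (R : realType) (p q n : nat) (P0 : set 'M[R]_(p, q))
    (phi : count_table p q n -> R) : Prop :=
  forall pi0 piA, P0 pi0 -> alternative P0 piA ->
    power_fun phi pi0 < power_fun phi piA.

Definition is_minimum (P : nat -> Prop) (m : nat) : Prop :=
  P m /\ forall n, P n -> (m <= n)%N.

Definition is_NTUB_threshold (R : realType) (p q : nat)
    (P0 : set 'M[R]_(p, q)) (m : nat) : Prop :=
  is_minimum
    (fun n => exists phi : count_table p q n -> R, is_test phi /\ NTUB P0 phi)
    m.

Definition is_SUB_threshold (R : realType) (p q : nat)
    (P0 : set 'M[R]_(p, q)) (m : nat) : Prop :=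
  is_minimum
    (fun n => exists phi : count_table p q n -> R, is_test phi /\ SUB P0 phi)
    m.

Definition rank_null (R : realType) (p q r : nat) : set 'M[R]_(p, q) :=
  [set pi | simplex pi /\ (\rank pi < r)%N].

Definition index_set (m r : nat) : Type := {I : {set 'I_m} | #|I| == r}.

(* enum_val lists the elements of I in increasing order; the cast identifies
   'I_r with 'I_#|I|. *)
Definition index_elt (m r : nat) (I : index_set m r) (k : 'I_r) : 'I_m :=
  enum_val (cast_ord (esym (eqP (valP I))) k).

Definition square_submx (R : realType) (p q r : nat) (pi : 'M[R]_(p, q))
    (I : index_set p r) (J : index_set q r) : 'M[R]_r :=
  mxsub (index_elt I) (index_elt J) pi.

(* Main.v *)
Require Import Defs.
From mathcomp Require Import all_boot all_order all_algebra.
From mathcomp Require Import all_classical all_reals.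
From mathcomp Require Import perm ring lra.

(* Lower bound: P_0 lies in the closure of P_A, so the power of an unbiased
   test is a constant alpha on P_0, and beta - alpha * (\sum pi)^n is a form f of
   degree n that is nonnegative on positive matrices and vanishes on those of
   rank < r.  By induction on s >= r - 1, f vanishes on all sums
   \sum_(k < s) t_k u_k v_k^T with t_k > 0 and u_k, v_k positive: as a form in t
   it vanishes when t_k = 0, and doubly so because t_k may become slightly
   negative inside the positive orthant, so f is divisible by \prod_k t_k^2, of
   degree 2s > n once s >= r.  Every table is a limit of such sums, whence
   beta = alpha.
   Existence: \sum det^2 is a form of degree 2r vanishing exactly in rank < r;
   dividing its coefficients by the multinomial ones gives the test. *)

Set Implicit Arguments.
Unset Strict Implicit.
Unset Printing Implicit Defensive.

Import Order.TTheory GRing.Theory Num.Theory.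

Local Open Scope ring_scope.

(** * Univariate polynomials and forms *)

(** The points [d / (k + 2)] with [k < size P] are distinct roots inside the open interval, more
    than the degree allows. *)
Lemma poly_eq0_near (R : realFieldType) (P : {poly R}) (d : R) :
  0 < d -> (forall y, 0 < y < d -> P.[y] = 0) -> P = 0.
Proof.
move=> d0 P0; pose f k : R := d / k.+2%:R.
apply: (@roots_geq_poly_eq0 _ P [seq f k | k <- iota 0 (size P)]).
- apply/allP => _ /mapP[k _ ->]; rewrite rootE P0 // divr_gt0 //=.
  by rewrite ltr_pdivrMr // ltr_pMr // ltr1n.
- rewrite map_inj_uniq ?iota_uniq // => i j /(mulfI (lt0r_neq0 d0)) /invr_inj.
  by move/eqP; rewrite eqr_nat => /eqP[].
- by rewrite size_map size_iota.
Qed.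

(** Right-continuity at 0, with a guard: nonnegativity is known only off the zeros of a nonzero
    polynomial [D]. If [P.[0] < 0], then [P] stays negative just to the right of 0, so [D] vanishes
    on an interval. *)
Lemma poly_ge0_at0 (R : realFieldType) (P D : {poly R}) (d : R) :
  0 < d -> D != 0 -> (forall y, 0 < y < d -> D.[y] != 0 -> 0 <= P.[y]) ->
  0 <= P.[0].
Proof.
move=> d0 D0 Ppos; rewrite leNgt; apply/negP => Pneg.
have [P1 P1E] : exists P1, P = P1 * 'X + (P.[0])%:P.
  have /factor_theorem[P1 HP1] : root (P - (P.[0])%:P) 0.
    by rewrite rootE !hornerE subrr.
  by exists P1; rewrite -[LHS](subrK (P.[0])%:P) HP1 subr0.
have [ub ubP] := poly_itv_bound P1 0 1.
have ub0 : 0 <= ub by apply: le_trans (ubP 0 _); rewrite ?lexx ?ler01.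
(* For [0 < y < e] this gives [P1.[y] * y <= ub * y < - P.[0]], hence [P.[y] < 0]. *)
pose e := Num.min d (Num.min 1 (- P.[0] / (ub + 1))).
have e0 : 0 < e by rewrite !lt_min d0 ltr01 divr_gt0 ?oppr_gt0 ?ltr_wpDl.
move/eqP: D0; apply; apply: (poly_eq0_near e0) => y.
rewrite !lt_min => /and4P[y0 yd y1]; rewrite ltr_pdivlMr ?ltr_wpDl // => ye.
apply/eqP; apply: contraT => Dy; have := Ppos y; rewrite y0 yd Dy => /(_ isT isT).
rewrite leNgt P1E !hornerE => /negP[].
have /ler_normlP[_ P1y] := ubP y (introT andP (conj (ltW y0) (ltW y1))).
have : P1.[y] * y <= ub * y by rewrite ler_pM2r.
by nra.
Qed.

(** Write [P = P1 * 'X]: the quotient [P1] is nonnegative to the right of 0 and nonpositive to the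
    left, so [P1.[0] = 0]. The left side is reduced to the right one by substituting [- 'X]. *)
Lemma poly_double_root (R : realFieldType) (P : {poly R}) (d : R) :
  0 < d -> P.[0] = 0 -> (forall y, - d < y < d -> 0 <= P.[y]) ->
  P`_0 = 0 /\ P`_1 = 0.
Proof.
move=> d0 P0 Ppos; split; first by rewrite -horner_coef0.
have /factor_theorem[P1] : root P 0 by rewrite rootE P0.
rewrite subr0 => PE; rewrite PE coefMX /= -horner_coef0.
have D0 : (1 : {poly R}) != 0 by rewrite oner_eq0.
apply/eqP; rewrite eq_le; apply/andP; split; last first.
  apply: (poly_ge0_at0 d0 D0) => y /andP[y0 yd] _.
  have := Ppos y; rewrite PE !hornerE pmulr_lge0 //; apply.
  by rewrite yd andbT; apply: lt_trans y0; rewrite oppr_lt0.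
rewrite -oppr_ge0.
have -> : - P1.[0] = (- (P1 \Po (- 'X))).[0] by rewrite !hornerE horner_comp !hornerE oppr0.
apply: (poly_ge0_at0 d0 D0) => y /andP[y0 yd] _.
rewrite hornerN horner_comp !hornerE; have := Ppos (- y).
rewrite PE !hornerE mulrN -mulNr pmulr_lge0 //; apply.
by rewrite ltrN2 yd /=; apply: lt_trans d0; rewrite oppr_lt0.
Qed.

(* [m.1] is a coefficient and the word [m.2] lists the variables of its monomial
   with multiplicity. *)
Definition is_form (R : comNzRingType) (J : eqType) (n : nat)
    (g : (J -> R) -> R) : Prop :=
  exists2 s : seq (R * seq J), all (fun m => size m.2 == n) s &
    forall t, g t = \sum_(m <- s) m.1 * \prod_(e <- m.2) t e.

Section Forms.
Variables (R : comNzRingType) (J : eqType).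
Implicit Types (g h : (J -> R) -> R) (n m : nat).

Lemma is_form_coord (e : J) : is_form 1 (fun t : J -> R => t e).
Proof.
exists [:: (1, [:: e])] => //= t.
by rewrite !big_seq1 /= mul1r.
Qed.

Lemma is_form_cst (a : R) : is_form 0 (fun _ : J -> R => a).
Proof. by exists [:: (a, [::])] => //= t; rewrite !big_seq1 /= big_nil mulr1. Qed.

Lemma is_formD n g h :
  is_form n g -> is_form n h -> is_form n (fun t => g t + h t).
Proof.
move=> [s sn gE] [s' sn' hE]; exists (s ++ s'); first by rewrite all_cat sn.
by move=> t; rewrite big_cat gE hE.
Qed.

Lemma is_formM n m g h :
  is_form n g -> is_form m h -> is_form (n + m) (fun t => g t * h t).
Proof.
move=> [s sn gE] [s' sn' hE].
exists [seq (a.1 * b.1, a.2 ++ b.2) | a <- s, b <- s'].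
  apply/allP => _ /allpairsP[[a b] /= [/(allP sn)/eqP an /(allP sn')/eqP bm ->]] /=.
  by rewrite size_cat an bm.
move=> t; rewrite big_allpairs_dep gE hE mulr_suml; apply: eq_bigr => a _.
rewrite mulr_sumr; apply: eq_bigr => b _.
by rewrite big_cat /= mulrACA.
Qed.

Lemma is_formZ n a g : is_form n g -> is_form n (fun t => a * g t).
Proof. exact: (is_formM (is_form_cst a)). Qed.

Lemma is_form0 n : is_form n (fun _ : J -> R => 0).
Proof. by exists [::] => // t; rewrite big_nil. Qed.

Lemma is_form_ext n g h : g =1 h -> is_form n g -> is_form n h.
Proof. by move=> gh [s sn gE]; exists s => // t; rewrite -gh. Qed.

Lemma is_form_sum I (s : seq I) n (G : I -> (J -> R) -> R) :
  (forall i, is_form n (G i)) -> is_form n (fun t => \sum_(i <- s) G i t).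
Proof.
move=> HG; elim: s => [|i s IH].
  by apply: is_form_ext (is_form0 n) => t; rewrite big_nil.
by apply: is_form_ext (is_formD (HG i) IH) => t; rewrite big_cons.
Qed.

Lemma is_form_prod I (s : seq I) (d : I -> nat) (G : I -> (J -> R) -> R) :
  (forall i, is_form (d i) (G i)) ->
  is_form (\sum_(i <- s) d i) (fun t => \prod_(i <- s) G i t).
Proof.
move=> HG; elim: s => [|i s IH].
  by rewrite big_nil; apply: is_form_ext (is_form_cst 1) => t; rewrite big_nil.
rewrite big_cons; apply: is_form_ext (is_formM (HG i) IH) => t.
by rewrite big_cons.
Qed.

Lemma is_form_exp n k g : is_form n g -> is_form (k * n) (fun t => g t ^+ k).
Proof.
move=> Hg; elim: k => [|k IH]; first exact: is_form_cst.
by rewrite mulSn; apply: is_form_ext (is_formM Hg IH) => t; rewrite exprS.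
Qed.

Lemma is_form_homog n g c t :
  is_form n g -> g (fun e => c * t e) = c ^+ n * g t.
Proof.
move=> [s sn gE]; rewrite !gE mulr_sumr; apply: eq_big_seq => m /(allP sn)/eqP <-.
by rewrite big_split /= big_const_seq count_predT iter_mulr_1 mulrCA.
Qed.

(** Restricts a form to a polynomial curve, where the univariate lemmas apply. *)
Lemma is_form_poly n g (t : J -> {poly R}) :
  is_form n g -> exists Q : {poly R}, forall y, Q.[y] = g (fun e => (t e).[y]).
Proof.
move=> [s _ gE]; exists (\sum_(m <- s) m.1 *: \prod_(e <- m.2) t e) => y.
rewrite gE horner_sum; apply: eq_bigr => m _.
by rewrite hornerZ horner_prod.
Qed.

End Forms.

Lemma is_form_comp (R : comNzRingType) (J K : eqType) n (g : (J -> R) -> R)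
    (L : J -> (K -> R) -> R) :
  is_form n g -> (forall e, is_form 1 (L e)) ->
  is_form n (fun t => g (fun e => L e t)).
Proof.
move=> [s sn gE] LP.
have : is_form n (fun t => \sum_(m <- s) m.1 * \prod_(e <- m.2) L e t).
  elim: s sn {gE} => [|m s IH] /=.
    by move=> _; apply: is_form_ext (is_form0 _ _ n) => t; rewrite big_nil.
  move=> /andP[/eqP mn /IH Hs].
  have Hm : is_form n (fun t => m.1 * \prod_(e <- m.2) L e t).
    apply: is_formZ; rewrite -mn -sum1_size.
    exact: (is_form_prod _ (d := fun=> 1%N)).
  by apply: is_form_ext (is_formD Hm Hs) => t; rewrite big_cons.
by apply: is_form_ext => t; rewrite gE.
Qed.

Lemma prod_seq_coord (R : comNzRingType) (J : eqType) (w : seq J) (j : J)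
    (t : J -> R) :
  \prod_(e <- w) (if e == j then 'X else (t e)%:P) =
  (\prod_(e <- w | e != j) t e) *: 'X^(count_mem j w).
Proof.
elim: w => [|e w IH]; first by rewrite !big_nil /= scale1r.
rewrite !big_cons IH /=; case: eqP => _ /=; first by rewrite add1n exprS scalerAr.
by rewrite mul_polyC scalerA.
Qed.

Lemma sum_count_mem (J : finType) (w : seq J) :
  (\sum_(j : J) count_mem j w)%N = size w.
Proof.
elim: w => [|e w IH]; first by rewrite big1.
rewrite /= big_split /= IH (bigD1 e) //= eqxx big1 ?addn0 ?add1n // => j.
by rewrite eq_sym => /negbTE->.
Qed.

(* Each exponent [count_mem j w] is forced to be at least 2, one index [j] at
   a time; after all indices no word of length below [2 * #|J|] survives. *)
Lemma form_double_zero (R : realFieldType) (J : finType) n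
    (g : (J -> R) -> R) :
  (n < 2 * #|J|)%N -> is_form n g ->
  (forall (t : J -> R) (j : J) (Q : {poly R}), (forall i, 0 < t i) ->
     (forall y, Q.[y] = g (fun e => if e == j then y else t e)) ->
     Q`_0 = 0 /\ Q`_1 = 0) ->
  forall t, (forall i, 0 < t i) -> g t = 0.
Proof.
move=> nJ [s sn gE] g2.
suff H (A : seq J) t : (forall i, 0 < t i) -> g t =
    \sum_(m <- s | all (fun j => 2 <= count_mem j m.2)%N A)
       m.1 * \prod_(e <- m.2) t e.
  move=> t t0; rewrite (H (enum J) t t0) big_seq_cond big1 // => m /andP[ms /allP mJ].
  have /eqP sz := allP sn m ms; exfalso.
  (* The length of a word is the sum of its letter counts, here at least 2 for each letter of
     [J]. *)
  move: nJ; rewrite ltnNge => /negP[]; rewrite -sz -sum_count_mem mulnC -sum_nat_const.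
  by apply: leq_sum => j _; rewrite mJ // mem_enum.
elim: A t => [|j A IH] t t0; first by rewrite gE; apply: eq_bigl.
pose x e : {poly R} := if e == j then 'X else (t e)%:P.
pose Q (P : pred (R * seq J)) := \sum_(m <- s | P m) m.1 *: \prod_(e <- m.2) x e.
have QE P y : (Q P).[y] = \sum_(m <- s | P m)
    m.1 * \prod_(e <- m.2) (if e == j then y else t e).
  rewrite horner_sum; apply: eq_bigr => m _; rewrite hornerZ horner_prod.
  by congr (_ * _); apply: eq_bigr => e _; rewrite /x; case: ifP; rewrite !hornerE.
pose PA (m : R * seq J) := all (fun j => 2 <= count_mem j m.2)%N A.
have QTE y : (Q xpredT).[y] = g (fun e => if e == j then y else t e).
  by rewrite QE gE.
(* The induction hypothesis holds for every positive value of the [j]-th variable, so it is an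
   identity of polynomials in that variable. *)
have QA : Q PA = Q xpredT.
  apply/eqP; rewrite -subr_eq0; apply/eqP; apply: (poly_eq0_near ltr01) => y /andP[y0 _].
  by rewrite hornerD hornerN QTE (IH _) ?QE ?subrr // => i; case: ifP.
have [Q0 Q1] := g2 t j _ t0 QTE.
have tE : (fun e => if e == j then t j else t e) = t.
  by apply/funext => e; case: eqP => // ->.
pose Pj (m : R * seq J) := (2 <= count_mem j m.2)%N.
have QAE : Q PA = Q (predI PA Pj) + Q (predI PA (predC Pj)) by rewrite /Q (bigID Pj).
have coefQ P i : (Q P)`_i = \sum_(m <- s | P m && (i == count_mem j m.2))
    m.1 * \prod_(e <- m.2 | e != j) t e.
  rewrite coef_sum big_mkcondr; apply: eq_bigr => m _.
  rewrite coefZ prod_seq_coord coefZ coefXn.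
  by case: ifP => _; rewrite ?mulr1 ?mulr0.
(* Words with fewer than two letters [j] contribute only to coefficients 0 and 1, where the other
   words contribute nothing. These coefficients vanish by the double zero, so the contributions
   cancel as a whole, though not necessarily word by word. *)
have Q2 : Q (predI PA (predC Pj)) = 0.
  apply/polyP => i; rewrite coef0; have [i2|i2] := ltnP i 2; last first.
    rewrite coefQ big1 // => m /andP[/andP[_ /=]].
    by rewrite /Pj -ltnNge => + /eqP mi; rewrite -mi ltnNge i2.
  have : (Q (predI PA Pj))`_i = 0.
    rewrite coefQ big1 // => m /andP[/andP[_ /=]].
    by rewrite /Pj => + /eqP mi; rewrite -mi leqNgt i2.
  have : (Q PA)`_i = 0 by rewrite QA; case: i i2 => [|[]].
  by rewrite QAE coefD => + QI; rewrite QI add0r.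
rewrite -{1}tE -QTE -QA QAE Q2 addr0 QE.
under eq_bigr do under eq_bigr do
  rewrite -[if _ then _ else _]/((fun e => if e == j then t j else t e) _) tE.
by apply: eq_bigl => m /=; rewrite andbC.
Qed.

(** * The multinomial distribution *)

(** Induction on the length, splitting the rearrangements by their first letter. *)
Lemma size_permutations_count (T : finType) (s : seq T) :
  (size (permutations s) * \prod_(e : T) (count_mem e s)`! = (size s)`!)%N.
Proof.
have [n] := ubnP (size s); elim: n s => // n IH s sn.
have [->|s0] := eqVneq s [::]; first by rewrite big1.
have s_gt0 : (0 < size s)%N by rewrite lt0n size_eq0.
rewrite (perm_size (permutationsE s_gt0)) size_allpairs_dep sumnE big_map.
rewrite big_distrl /=.
(* Removing [e] lowers only its own count, by one; the missing factor of the factorial is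
   [count_mem e s]. *)
have E e : e \in undup s -> (size (permutations (rem e s)) *
    \prod_(i : T) (count_mem i s)`! = count_mem e s * (size s).-1`!)%N.
  rewrite mem_undup => es; have sz := size_rem es.
  rewrite -sz -IH; last first.
    by rewrite sz prednK.
  rewrite mulnCA; congr (_ * _)%N; rewrite (bigD1 e) //= [in RHS](bigD1 e) //=.
  rewrite mulnA count_mem_rem eqxx subn1 -[in LHS](prednK (n := count_mem e s)) ?factS.
    rewrite prednK -?has_count ?has_pred1 //; congr (_ * _)%N; apply: eq_bigr => i ie.
    by rewrite count_mem_rem eq_sym (negbTE ie) subn0.
  by rewrite -has_count has_pred1.
rewrite big_seq (eq_bigr _ E) -big_seq -big_distrl /=.
have -> : (\sum_(i <- undup s) count_mem i s = size s)%N.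
  rewrite -[RHS]sum_count_mem big_uniq ?undup_uniq //= [RHS](bigID (mem (undup s))) /=.
  rewrite [X in (_ + X)%N]big1 ?addn0 //.
  by move=> i; rewrite mem_undup => /count_memPn.
by case: (s) s0 => //= x s' _; rewrite factS.
Qed.

Section Multinomial.
Variables (R : realType) (p q n : nat).
Implicit Types (x : count_table p q n) (pi : 'M[R]_(p, q)).

(** A word is an ordered sample of cells, and this is its table of counts. [inord] is faithful for
    words of length [n], whose counts are at most [n]. *)
Definition word_table (w : seq ('I_p * 'I_q)) : 'M['I_n.+1]_(p, q) :=
  \matrix_(i, j) inord (count_mem (i, j) w).

Lemma word_tableE (w : seq ('I_p * 'I_q)) i j :
  size w = n -> word_table w i j = count_mem (i, j) w :> nat.
Proof.
by move=> wn; rewrite mxE inordK // ltnS -wn count_size.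
Qed.

Lemma word_table_count (w : seq ('I_p * 'I_q)) :
  size w = n -> exists x, val x = word_table w.
Proof.
move=> wn; have wP : (\sum_i \sum_j (word_table w i j : nat))%N == n.
  rewrite pair_bigA /= -[X in _ == X]wn -sum_count_mem; apply/eqP.
  by apply: eq_bigr => -[i j] _; rewrite word_tableE.
by exists (exist _ (word_table w) wP : count_table p q n).
Qed.

Lemma count_table_word x : exists2 w : seq ('I_p * 'I_q), size w = n &
  val x = word_table w.
Proof.
pose w := flatten [seq nseq (val x e.1 e.2) e | e <- enum {: 'I_p * 'I_q}].
have wc e : count_mem e w = val x e.1 e.2.
  rewrite /w count_flatten -map_comp sumnE big_map big_enum /= (bigD1 e) //=.
  rewrite count_nseq /= eqxx mul1n big1 ?addn0 // => e' /negbTE ee'.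
  by rewrite count_nseq /= ee'.
have wn : size w = n.
  rewrite -sum_count_mem; under eq_bigr do rewrite wc.
  by rewrite -(pair_bigA _ (fun i j => val x i j : nat)) /=; apply/eqP/(valP x).
exists w => //; apply/matrixP => i j; apply: ord_inj.
by rewrite word_tableE // wc.
Qed.

Lemma prod_word (w : seq ('I_p * 'I_q)) pi : size w = n ->
  \prod_(e <- w) pi e.1 e.2 = \prod_i \prod_j pi i j ^+ word_table w i j.
Proof.
move=> wn; rewrite pair_bigA /=.
under [RHS]eq_bigr => e _ do rewrite word_tableE // -surjective_pairing.
elim: w {wn} => [|e w IH]; first by rewrite big_nil big1.
rewrite big_cons IH.
under [RHS]eq_bigr do rewrite exprD.
rewrite big_split /=; congr (_ * _).
rewrite (bigD1 e) //= eqxx big1 ?mulr1 // => e' /negbTE.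
by rewrite eq_sym => ->.
Qed.

(** The ordered samples with table [x] are exactly the rearrangements of any one of them. *)
Lemma card_word_table x :
  (#|[set w : n.-tuple ('I_p * 'I_q) | word_table w == val x]| *
     \prod_i \prod_j (val x i j)`! = n`!)%N.
Proof.
have [s sn xs] := count_table_word x.
rewrite -[in RHS]sn -size_permutations_count; congr (_ * _)%N; last first.
  by rewrite pair_bigA; apply: eq_bigr => -[i j] _; rewrite xs word_tableE.
rewrite cardE -(size_map val); apply: perm_size; apply: uniq_perm.
- by rewrite map_inj_uniq ?enum_uniq //; apply: ord_inj.
- exact: permutations_uniq.
move=> w; rewrite mem_permutations; apply/mapP/idP => [[t]|sw].
  rewrite mem_enum inE xs => /eqP ts ->; apply/allP => -[i j] _ /=.
  by apply/eqP; rewrite -!word_tableE ?ts ?size_tuple.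
have wn : size w == n by rewrite (perm_size sw) sn.
exists (Tuple wn) => //; rewrite mem_enum inE xs; apply/eqP/matrixP => i j.
by apply: ord_inj; rewrite !word_tableE ?(eqP wn) //=; exact: (seq.permP sw).
Qed.

Definition multinomial_coef x : R := (n`!)%:R / (\prod_i \prod_j (val x i j)`!)%N%:R.

Lemma multinomial_coefE x : multinomial_coef x =
  #|[set w : n.-tuple ('I_p * 'I_q) | word_table w == val x]|%:R.
Proof.
rewrite /multinomial_coef -(card_word_table x) natrM mulfK // pnatr_eq0 -lt0n.
by rewrite prodn_gt0 // => i; rewrite prodn_gt0 // => j; rewrite fact_gt0.
Qed.

Lemma multinomial_coef_gt0 x : 0 < multinomial_coef x.
Proof.
rewrite divr_gt0 // ltr0n ?fact_gt0 //.
by rewrite prodn_gt0 // => i; rewrite prodn_gt0 // => j; rewrite fact_gt0.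
Qed.

Lemma sum_word_table (w : seq ('I_p * 'I_q)) (F : count_table p q n -> R) a :
  size w = n -> (forall x, val x = word_table w -> F x = a) ->
  \sum_(x : count_table p q n | word_table w == val x) F x = a.
Proof.
move=> /word_table_count[x xw] Fa; rewrite (big_pred1 x) ?Fa // => y /=.
by rewrite -xw eq_sym val_eqE.
Qed.

(** Expand the power into a sum over words of length [n] and group the words by their tables. *)
Lemma sum_multinomial_pmf pi :
  \sum_(x : count_table p q n) multinomial_pmf pi x = (\sum_i \sum_j pi i j) ^+ n.
Proof.
rewrite pair_bigA /= -[in RHS](card_ord n) -prodr_const.
rewrite bigA_distr_bigA /=.
rewrite (reindex (fun w : n.-tuple ('I_p * 'I_q) => [ffun i => tnth w i])) /=; last first.
  exists (fun f : {ffun _} => [tuple f i | i < n]) => [w _|f _].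
    by apply: eq_from_tnth => i; rewrite tnth_mktuple ffunE.
  by apply/ffunP => i; rewrite ffunE tnth_mktuple.
transitivity (\sum_(w : n.-tuple ('I_p * 'I_q)) \sum_(x : count_table p q n | word_table w == val x)
   \prod_i \prod_j pi i j ^+ val x i j).
  rewrite (exchange_big_dep xpredT) //=; apply: eq_bigr => x _.
  rewrite sumr_const -mulr_natl /multinomial_pmf -/(multinomial_coef x) multinomial_coefE.
  by rewrite cardsE.
apply: eq_bigr => w _; transitivity (\prod_(e <- w) pi e.1 e.2).
  by apply: sum_word_table; rewrite ?size_tuple // => x ->; rewrite prod_word ?size_tuple.
by rewrite big_tuple; apply: eq_bigr => i _; rewrite ffunE.
Qed.

(** Different words may denote the same monomial: add up the coefficients of all words with table
    [x], then divide by the multinomial coefficient. The weights [d] are arbitrary reals and need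
    not form a test. *)
Lemma form_power (g : ('I_p * 'I_q -> R) -> R) : is_form n g ->
  exists d : count_table p q n -> R,
    forall pi, g (fun e => pi e.1 e.2) = power_fun d pi.
Proof.
move=> [s sn gE].
exists (fun x => (\sum_(m <- s | word_table m.2 == val x) m.1) / multinomial_coef x).
move=> pi; rewrite gE /power_fun.
under [RHS]eq_bigr => x _.
  rewrite /multinomial_pmf -/(multinomial_coef x) mulrA divfK; last first.
    by rewrite lt0r_neq0 // multinomial_coef_gt0.
  rewrite mulr_suml; over.
rewrite (exchange_big_dep xpredT) //=.
apply: eq_big_seq => m /(allP sn)/eqP mn.
by apply/esym/sum_word_table => // x ->; rewrite prod_word.
Qed.

Lemma power_funE (phi : count_table p q n -> R) pi : power_fun phi pi =
  \sum_x phi x * multinomial_coef x * \prod_i \prod_j pi i j ^+ val x i j.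
Proof. by apply: eq_bigr => x _; rewrite -mulrA. Qed.

Lemma power_fun_form (phi : count_table p q n -> R) :
  is_form n (fun t : 'I_p * 'I_q -> R => power_fun phi (\matrix_(i, j) t (i, j))).
Proof.
have: is_form n (fun t => \sum_x phi x * multinomial_coef x *
    \prod_(e : 'I_p * 'I_q) t e ^+ val x e.1 e.2).
  apply: is_form_sum => x; apply: is_formZ.
  suff: (\sum_(e : 'I_p * 'I_q) val x e.1 e.2 * 1)%N = n.
    by move=> {1}<-; apply: is_form_prod => e; apply/is_form_exp/is_form_coord.
  under eq_bigr do rewrite muln1.
  by rewrite -(pair_bigA _ (fun i j => val x i j : nat)) /=; apply/eqP/(valP x).
apply: is_form_ext => t; rewrite power_funE; apply: eq_bigr => x _.
rewrite pair_bigA /=; congr (_ * _); apply: eq_bigr => -[i j] _.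
by rewrite mxE.
Qed.

End Multinomial.

(** * Sums of squared minors *)

Lemma leq_rank_minor (F : fieldType) (m n k : nat) (A : 'M[F]_(m, n))
    (f : 'I_k -> 'I_m) (g : 'I_k -> 'I_n) :
  \det (mxsub f g A) != 0 -> (k <= \rank A)%N.
Proof.
rewrite -unitfE -unitmxE => /mxrank_unit {1}<-.
have -> : mxsub f g A = rowsub f (colsub g A) by apply/matrixP => i j; rewrite !mxE.
apply: leq_trans (mxrankS (rowsub_sub _ _)) _.
have E : (colsub g A)^T = rowsub g A^T by apply/matrixP => i j; rewrite !mxE.
by rewrite -mxrank_tr -[X in (_ <= X)%N]mxrank_tr E mxrankS ?rowsub_sub.
Qed.

Lemma minor_of_rank (F : fieldType) (m n k : nat) (A : 'M[F]_(m, n)) :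
  (k <= \rank A)%N -> exists f : 'I_k -> 'I_m, exists g : 'I_k -> 'I_n,
    [/\ injective f, injective g & \det (mxsub f g A) != 0].
Proof.
move=> kA; pose f := maxrankfun A \o widen_ord kA.
have wI : injective (widen_ord kA) by move=> i j /(congr1 val) /= /ord_inj.
have fI : injective f by apply: inj_comp wI; apply: maxrankfun_inj.
have fF : row_full (rowsub f A)^T.
  rewrite /row_full mxrank_tr -/(row_free _).
  (* Choosing [k] of the independent rows is multiplication by a selection matrix, which has rank
     [k] because it contains an identity minor. *)
  have -> : rowsub f A = rowsub (widen_ord kA) (1%:M) *m rowsub (maxrankfun A) A.
    by rewrite -rowsubE; apply/matrixP => i j; rewrite !mxE.
  rewrite /row_free mxrankMfree ?maxrowsub_free //.
  apply/eqP/anti_leq; rewrite rank_leq_row /=.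
  apply: (leq_rank_minor (f := id) (g := widen_ord kA)).
  have -> : mxsub id (widen_ord kA) (rowsub (widen_ord kA) 1%:M) = 1%:M :> 'M[F]_k.
    by apply/matrixP => i j; rewrite !mxE (inj_eq wI).
  by rewrite det1 oner_eq0.
exists f, (fullrankfun fF); split=> //; first exact: fullrankfun_inj.
rewrite -unitfE -unitmxE -unitmx_tr.
have -> : (mxsub f (fullrankfun fF) A)^T = rowsub (fullrankfun fF) (rowsub f A)^T.
  by apply/matrixP => i j; rewrite !mxE.
exact: fullrowsub_unit.
Qed.

(** An injection is the enumeration of its image after a permutation, so minors taken along
    injections agree up to sign with those along index sets. *)
Lemma index_elt_perm (m k : nat) (f : 'I_k -> 'I_m) : injective f ->
  exists I : index_set m k, exists s : 'S_k, f =1 index_elt I \o s.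
Proof.
move=> fI; have cI : #|f @: 'I_k| == k by rewrite card_imset // card_ord.
pose I : index_set m k := exist _ (f @: 'I_k) cI; exists I.
have fk i : exists j, index_elt I j == f i.
  have fi : f i \in f @: 'I_k by rewrite imset_f.
  exists (cast_ord (eqP (valP I)) (enum_rank_in fi (f i))).
  by rewrite /index_elt cast_ordK enum_rankK_in.
pose h i := xchoose (fk i).
have hE i : index_elt I (h i) = f i by apply/eqP/(xchooseP (fk i)).
have hI : injective h by move=> i j hij; apply: fI; rewrite -!hE hij.
by exists (perm hI) => i /=; rewrite permE hE.
Qed.

Definition sum_minors (R : realType) (p q r : nat) (pi : 'M[R]_(p, q)) : R :=
  \sum_(I : index_set p r) \sum_(J : index_set q r) \det (square_submx pi I J) ^+ 2.

Section SumMinors.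
Variables (R : realType) (p q r : nat).
Implicit Type pi : 'M[R]_(p, q).

Lemma sum_minors_eq0 pi : (\rank pi < r)%N -> sum_minors r pi = 0.
Proof.
move=> pir; rewrite /sum_minors big1 // => I _; rewrite big1 // => J _.
apply/eqP; rewrite sqrf_eq0; apply: contraTT pir => /leq_rank_minor.
by rewrite -leqNgt.
Qed.

Lemma sum_minors_gt0 pi : (r <= \rank pi)%N -> 0 < sum_minors r pi.
Proof.
move=> /minor_of_rank[f [g [/index_elt_perm[I [s fE]] /index_elt_perm[J [t gE]] d0]]].
rewrite /sum_minors (bigD1 I) //= ltr_pwDl //; last first.
  by apply: sumr_ge0 => I' _; apply: sumr_ge0 => J' _; apply: sqr_ge0.
rewrite (bigD1 J) //= ltr_pwDl ?sumr_ge0 // => [|J' _]; last exact: sqr_ge0.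
rewrite lt0r sqr_ge0 andbT sqrf_eq0; apply: contraNneq d0 => d0.
have -> : mxsub f g pi = row_perm s (col_perm t (square_submx pi I J)).
  by apply/matrixP => i j; rewrite !mxE fE gE.
by rewrite row_permE col_permE !det_mulmx d0 mul0r mulr0.
Qed.

Lemma sum_minors_form :
  is_form (2 * r) (fun t : 'I_p * 'I_q -> R => sum_minors r (\matrix_(i, j) t (i, j))).
Proof.
apply: is_form_sum => I; apply: is_form_sum => J; apply: is_form_exp.
(* The determinant is unfolded to its Leibniz sum, a form of degree [r]. *)
apply: is_form_sum => s; apply: is_formZ.
have : is_form r (fun t : 'I_p * 'I_q -> R =>
    \prod_(i < r) t (index_elt I i, index_elt J (s i))).
  rewrite -[X in is_form X](card_ord r) -sum1_card.
  by apply: (is_form_prod _ (d := fun=> 1%N)) => i; apply: is_form_coord.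
by apply: is_form_ext => t; apply: eq_bigr => i _; rewrite !mxE.
Qed.

Lemma sum_minors_test (alpha : R) : 0 < alpha < 1 ->
  exists2 c : R, 0 < c & exists phi : count_table p q (2 * r) -> R,
    is_test phi /\ forall pi, simplex pi ->
      power_fun phi pi = c * sum_minors r pi + alpha.
Proof.
move=> /andP[a0 a1]; have [d dE] := form_power sum_minors_form.
(* [D] is positive and bounds every weight, so [c * d x] moves [alpha] by at most its distance to 0
   and to 1. *)
pose D := 1 + \sum_x `|d x|; have D0 : 0 < D by rewrite ltr_pwDl ?sumr_ge0.
pose c := Num.min alpha (1 - alpha) / D.
have c0 : 0 < c by rewrite divr_gt0 // lt_min a0 subr_gt0.
exists c => //; exists (fun x => c * d x + alpha); split=> [x|pi [_ pi1]].
  have : `|c * d x| <= Num.min alpha (1 - alpha).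
    rewrite normrM (gtr0_norm c0) /c -mulrAC ler_pdivrMr // ler_wpM2l //.
      by rewrite le_min (ltW a0) subr_ge0 ltW.
    by rewrite /D (bigD1 x) //= addrCA lerDl addr_ge0 // sumr_ge0.
  by rewrite le_min !ler_norml => /andP[/andP[? ?] /andP[? ?]]; lra.
rewrite /power_fun; under eq_bigr do rewrite mulrDl -mulrA.
(* The constant weight contributes [alpha] times the total probability, which is 1 on the
   simplex. *)
rewrite big_split /= -!mulr_sumr sum_multinomial_pmf pi1 expr1n mulr1.
rewrite -/(power_fun d pi) -dE; congr (_ * sum_minors _ _ + _).
by apply/matrixP => i j; rewrite mxE.
Qed.

End SumMinors.

(** * Tests of small sample size *)

(** The inverse of one plus the sum of all inverses lies below each value; the added 1 also covers
    an empty index type. *)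
Lemma fin_lower_bound (R : realFieldType) (I : finType) (c : I -> R) :
  (forall i, 0 < c i) -> exists2 d, 0 < d & forall i, d <= c i.
Proof.
move=> c0; pose S := 1 + \sum_i (c i)^-1.
have S0 : 0 < S by rewrite ltr_pwDl // sumr_ge0 // => i _; rewrite invr_ge0 ltW.
exists S^-1 => [|i]; first by rewrite invr_gt0.
rewrite -[leRHS]invrK lef_pV2 ?posrE ?invr_gt0 // /S (bigD1 i) //= addrCA lerDl.
by rewrite addr_ge0 // sumr_ge0 // => k _; rewrite invr_ge0 ltW.
Qed.

Lemma simplex_of_rank (R : realType) (p q k : nat) :
  (0 < k <= minn p q)%N -> exists2 B : 'M[R]_(p, q), simplex B & \rank B = k.
Proof.
rewrite leq_min => /and3P[k0 kp kq].
have k1 : k%:R != 0 :> R by rewrite pnatr_eq0 -lt0n.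
(* The uniform distribution on the first [k] diagonal cells. *)
exists (k%:R^-1 *: pid_mx k); last by rewrite mxrank_scale_nz ?invr_eq0 // rank_pid_mx.
split=> [i j|]; first by rewrite !mxE mulr_ge0 ?invr_ge0 ?ler0n.
transitivity (\sum_(i < p | (i < k)%N) (k%:R^-1 : R)).
  rewrite [RHS]big_mkcond; apply: eq_bigr => i _; case: ifP => ik; last first.
    by rewrite big1 // => j _; rewrite !mxE ik andbF mulr0.
  rewrite (bigD1 (Ordinal (leq_trans ik kq))) //= !mxE /= eqxx ik mulr1.
  rewrite big1 ?addr0 // => j; rewrite -val_eqE /= eq_sym => /negbTE ij.
  by rewrite !mxE ij mulr0.
by rewrite -(big_ord_widen _ (fun=> _)) // sumr_const card_ord -[_ *+ _]mulr_natl divff.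
Qed.

Section LowerBound.
Variables (R : realType) (p q r n : nat).
Hypothesis hr : (2 <= r <= minn p q)%N.
Variable phi : count_table p q n -> R.
Hypothesis phiU : unbiased (@rank_null R p q r) phi.

(* Tables of rank at least [r] approximate [pi1] along a line on which some
   minor of order [r] is not identically zero. *)
Lemma unbiased_null_le pi0 pi1 :
  rank_null r pi0 -> rank_null r pi1 -> power_fun phi pi0 <= power_fun phi pi1.
Proof.
move=> n0 n1; have [[s1 e1] _] := n1.
have [|B [B0 B1] Br] := @simplex_of_rank R p q r.
  by case/andP: hr => /ltnW -> ->.
have [f [g [_ _ d0]]] := minor_of_rank (eq_leq (esym Br)).
(* The line through [pi1] at parameter 0 and the rank [r] table [B] at parameter 1; its minor [D] is
   nonzero since it is nonzero at 1. *)
pose P : 'M[{poly R}]_(p, q) := \matrix_(i, j) ((pi1 i j)%:P + (B i j - pi1 i j) *: 'X).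
pose Pat y : 'M[R]_(p, q) := map_mx (horner_eval y) P.
have PE y : Pat y = \matrix_(i, j) ((1 - y) * pi1 i j + y * B i j).
  by apply/matrixP => i j; rewrite !mxE /horner_eval !hornerE; ring.
have [Q QE] := is_form_poly (fun e => P e.1 e.2) (power_fun_form phi).
have {}QE y : Q.[y] = power_fun phi (Pat y).
  by rewrite QE; congr power_fun; apply/matrixP => i j; rewrite !mxE.
pose D := \det (mxsub f g P).
have DE y : D.[y] = \det (mxsub f g (Pat y)).
  rewrite -/(horner_eval y D) -det_map_mx; congr (\det _).
  by apply/matrixP => i j; rewrite !mxE.
have D0 : D != 0.
  have BE : \det (mxsub f g B) = D.[1].
    rewrite DE; congr (\det _); apply/matrixP => i j.
    by rewrite PE !mxE; ring.
  by apply: contraNneq d0 => D0; rewrite BE D0 horner0.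
have := @poly_ge0_at0 R (Q - (power_fun phi pi0)%:P) D 1 ltr01 D0.
rewrite !hornerE QE subr_ge0.
have -> : Pat 0 = pi1.
  by rewrite PE; apply/matrixP => i j; rewrite mxE; ring.
(* Where [D.[y]] is nonzero, the table on the segment has rank at least [r] and lies in the
   alternative. *)
apply=> y /andP[y0 y1]; rewrite DE !hornerE QE subr_ge0 => /leq_rank_minor yr.
apply: phiU => //; split; last by case=> _; rewrite ltnNge yr.
rewrite PE; split=> [i j|].
  by rewrite mxE addr_ge0 // mulr_ge0 // ?subr_ge0 ltW.
under eq_bigr do under eq_bigr do rewrite mxE.
under eq_bigr do rewrite big_split /= -!mulr_sumr.
by rewrite big_split /= -!mulr_sumr e1 B1; ring.
Qed.

Variable pi0 : 'M[R]_(p, q).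
Hypothesis pi0N : rank_null r pi0.

Implicit Type M : 'M[R]_(p, q).

(** The power minus its value at [pi0], made homogeneous so that its sign and zeros pass from the
    simplex to all positive matrices. *)
Definition excess M : R :=
  power_fun phi M - power_fun phi pi0 * (\sum_i \sum_j M i j) ^+ n.

Lemma excess_form : is_form n (fun t : 'I_p * 'I_q -> R => excess (\matrix_(i, j) t (i, j))).
Proof.
have H : is_form n (fun t : 'I_p * 'I_q -> R =>
    - power_fun phi pi0 * (\sum_(e : 'I_p * 'I_q) t e) ^+ n).
  rewrite -[X in is_form X]muln1; apply/is_formZ/is_form_exp/is_form_sum => e.
  exact: is_form_coord.
apply: is_form_ext (is_formD (power_fun_form phi) H) => t.
rewrite /excess mulNr; congr (_ - _ * _ ^+ _); rewrite pair_bigA /=.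
by apply: eq_bigr => -[i j] _; rewrite mxE.
Qed.

Lemma excessE (t : 'I_p * 'I_q -> R) M :
  (forall i j, t (i, j) = M i j) -> excess (\matrix_(i, j) t (i, j)) = excess M.
Proof. by move=> tM; congr excess; apply/matrixP => i j; rewrite mxE. Qed.

Lemma excess_simplex M : simplex M -> excess M = power_fun phi M - power_fun phi pi0.
Proof. by move=> [_ M1]; rewrite /excess M1 expr1n mulr1. Qed.

Lemma excess_normalize M : (forall i j, 0 < M i j) ->
  exists c, exists M', [/\ 0 < c, simplex M', \rank M' = \rank M & excess M = c * excess M'].
Proof.
move=> M0; pose c := \sum_i \sum_j M i j.
have c0 : 0 < c.
  case/andP: hr => r2; rewrite leq_min => /andP[/(leq_trans r2) p2 /(leq_trans r2) q2].
  have p0 := ltnW p2; have q0 := ltnW q2.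
  rewrite /c (bigD1 (Ordinal p0)) //= (bigD1 (Ordinal q0)) //=.
  have M1 i j : 0 <= M i j by apply: ltW.
  by rewrite -addrA ltr_pwDl // addr_ge0 // sumr_ge0 // => i _; rewrite sumr_ge0.
have cN := lt0r_neq0 c0.
(* Dividing by the total [c] lands in the simplex; by homogeneity the excess scales by [c ^+ n]. *)
exists (c ^+ n), (c^-1 *: M); split; first exact: exprn_gt0.
- split=> [i j|]; first by rewrite mxE mulr_ge0 ?invr_ge0 ?ltW.
  under eq_bigr do under eq_bigr do rewrite mxE.
  under eq_bigr do rewrite -mulr_sumr.
  by rewrite -mulr_sumr mulVf.
- by rewrite mxrank_scale_nz ?invr_eq0.
have H := is_form_homog c (fun e => (c^-1 *: M) e.1 e.2) excess_form.
rewrite -[LHS](excessE (t := fun e => c * (c^-1 *: M) e.1 e.2)) ?H ?(excessE (M := c^-1 *: M)) //.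
by move=> i j; rewrite !mxE mulrA divff ?mul1r.
Qed.

Lemma excess_ge0 M : (forall i j, 0 < M i j) -> 0 <= excess M.
Proof.
move=> /excess_normalize[c [M' [c0 M'1 _ ->]]]; rewrite pmulr_rge0 // excess_simplex //.
rewrite subr_ge0; have [Mr|Mr] := ltnP (\rank M') r; first exact: unbiased_null_le.
by apply: phiU => //; split=> // -[_]; rewrite ltnNge Mr.
Qed.

(** The power is constant on the null hypothesis, by [unbiased_null_le] in both directions. *)
Lemma excess_null M : (forall i j, 0 < M i j) -> (\rank M < r)%N -> excess M = 0.
Proof.
move=> /excess_normalize[c [M' [_ M'1 <- ->]]] Mr.
rewrite excess_simplex // (_ : power_fun phi M' = power_fun phi pi0) ?subrr ?mulr0 //.
by apply: le_anti; rewrite !unbiased_null_le.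
Qed.


Lemma mulmx_gt0 s (A : 'M[R]_(p, s.+1)) (B : 'M[R]_(s.+1, q)) :
  (forall i k, 0 < A i k) -> (forall k j, 0 < B k j) -> forall i j, 0 < (A *m B) i j.
Proof.
move=> A0 B0 i j; rewrite mxE big_ord_recl ltr_pwDl ?mulr_gt0 // sumr_ge0 // => k _.
by rewrite mulr_ge0 ?ltW.
Qed.

Hypothesis nr : (n < 2 * r)%N.

(* In [\sum_k t k * u_k v_k^T] the coefficient [t j] may go slightly below 0
   without leaving the positive orthant, so the excess, which vanishes at
   [t j = 0], has a double zero there. *)
Lemma excess_mulmx_eq0 k (A : 'M[R]_(p, r.-1 + k)) (B : 'M[R]_(r.-1 + k, q)) :
  (forall i l, 0 < A i l) -> (forall l j, 0 < B l j) -> excess (A *m B) = 0.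
Proof.
have r1 : (0 < r.-1)%N by case/andP: hr; case: (r) => [|[]].
elim: k A B => [|k IH] A B A0 B0.
  (* An inner dimension of [r.-1] forces rank below [r]; it is at least 1, so the product is
     positive. *)
  apply: excess_null.
    move: A B A0 B0; rewrite addn0; case: (r.-1) r1 => // r' _ A B A0 B0.
    exact: mulmx_gt0.
  apply: leq_ltn_trans (mulmx_max_rank _ _) _.
  by rewrite addn0; case: (r) r1 => [|[|r']] //=; rewrite ltnSn.
move: A B A0 B0; rewrite addnS; set s := (r.-1 + k)%N => A B A0 B0.
have s0 : (0 < s)%N by rewrite ltn_addr.
(* Entries of the rank one terms; [L e t] is the cell [e] of their combination with coefficients
   [t], and the goal is the case of all coefficients 1. *)
pose a i l j := A i l * B l j.
have a0 i l j : 0 < a i l j by rewrite mulr_gt0.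
pose L (e : 'I_p * 'I_q) (t : 'I_s.+1 -> R) := \sum_l a e.1 l e.2 * t l.
have Lform e : is_form 1 (L e).
  by apply: is_form_sum => l; apply/is_formZ/is_form_coord.
have gform := is_form_comp excess_form Lform.
rewrite -[LHS](excessE (t := fun e => L e (fun=> 1))); last first.
  by move=> i j; rewrite mxE; apply: eq_bigr => l _; rewrite mulr1.
apply: (form_double_zero _ gform) => //.
  (* There are [s.+1] variables, at least [r], whence [n < 2 * r <= 2 * s.+1]. *)
  rewrite card_ord; apply: leq_trans nr _; rewrite leq_mul2l /= /s -addSn prednK ?leq_addr //.
  by case/andP: hr => /ltnW.
move=> t j Q t0 QE.
(* A second term, available since [s > 0]. The bound [d] makes it outweigh, in every cell, a
   coefficient of term [j] above [- d]. *)
pose j' := lift j (Ordinal s0).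
have [|d d0 dP] := @fin_lower_bound R _ (fun e : 'I_p * 'I_q =>
    a e.1 j' e.2 * t j' / a e.1 j e.2).
  by move=> e; rewrite divr_gt0 ?mulr_gt0.
have LE e y : L e (fun l => if l == j then y else t l) =
    a e.1 j e.2 * y + \sum_l a e.1 (lift j l) e.2 * t (lift j l).
  rewrite /L (bigD1_ord j) //= eqxx; congr (_ + _); apply: eq_bigr => l _.
  by rewrite eq_sym (negbTE (neq_lift _ _)).
apply: (poly_double_root d0) => [|y /andP[dy yd]].
  (* At 0 the term [j] drops out; the remaining coefficients are absorbed into the left factor,
     leaving a product of inner dimension [s]. *)
  rewrite QE (excessE (t := fun e => L e (fun l => if l == j then 0 else t l))
    (M := (\matrix_(i, l) (A i (lift j l) * t (lift j l))) *m
     (\matrix_(l, i) B (lift j l) i))).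
    by apply: IH => *; rewrite mxE ?mulr_gt0.
  move=> i l; rewrite LE mulr0 add0r mxE; apply: eq_bigr => m _.
  by rewrite !mxE mulrAC.
rewrite QE; apply: excess_ge0 => i l; rewrite mxE LE /=.
have := dP (i, l); rewrite /= ler_pdivlMr // (bigD1 (Ordinal s0)) //= -/j' => da.
rewrite addrA ltr_wpDr ?sumr_ge0 // => [m _|]; first by rewrite mulr_ge0 ?ltW.
have : a i j l * - d < a i j l * y by rewrite ltr_pM2l.
lra.
Qed.

(** Perturb [pi = pi *m 1%:M] by adding [y > 0] to all entries of both factors. These are positive
    with inner dimension [q >= r.-1], so the excess vanishes for small [y], and being polynomial in
    [y] it vanishes at 0. *)
Lemma power_fun_null_const pi : simplex pi -> power_fun phi pi = power_fun phi pi0.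
Proof.
move=> pi1; apply/eqP; rewrite -subr_eq0 -excess_simplex //.
have [Q QE] := is_form_poly (fun e => ((map_mx polyC pi + const_mx 'X) *m
  (1%:M + const_mx 'X : 'M[{poly R}]_q)) e.1 e.2) excess_form.
have {}QE y : Q.[y] = excess ((pi + const_mx y) *m (1%:M + const_mx y)).
  rewrite QE; apply: (congr1 excess); apply/matrixP => i j.
  rewrite !mxE horner_sum; apply: eq_bigr => k _.
  by rewrite !mxE !hornerE; case: eqP => _; rewrite ?hornerE.
have -> : excess pi = Q.[0] by rewrite QE !raddf0 !addr0 mulmx1.
suff -> : Q = 0 by rewrite horner0.
apply: (poly_eq0_near ltr01) => y /andP[y0 _]; rewrite QE.
have rq : (r.-1 <= q)%N.
  by case/andP: hr => _; rewrite leq_min => /andP[_]; apply: leq_trans (leq_pred r).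
have pos1 i j : 0 < (pi + const_mx y) i j.
  by rewrite !mxE ltr_wpDl //; case: pi1.
have pos2 i j : 0 < (1%:M + const_mx y : 'M[R]_q) i j.
  by rewrite !mxE ltr_wpDl.
have H k (A : 'M[R]_(p, k)) (B : 'M[R]_(k, q)) : (r.-1 <= k)%N ->
    (forall i l, 0 < A i l) -> (forall l j, 0 < B l j) -> excess (A *m B) = 0.
  by move=> /subnKC kE; move: A B; rewrite -kE => A B; apply: excess_mulmx_eq0.
exact: H.
Qed.

End LowerBound.

(** * The two thresholds *)

Lemma NTUB_sample_size (R : realType) (p q r n : nat) (phi : count_table p q n -> R) :
  (2 <= r <= minn p q)%N -> NTUB (@rank_null R p q r) phi -> (2 * r <= n)%N.
Proof.
move=> hr [phiU [pi1 [pi2 [s1 s2 ne]]]]; rewrite leqNgt; apply/negP => nr.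
have [|pi0 s0 r0] := @simplex_of_rank R p q 1.
  by case/andP: hr => r2 /(leq_trans (ltnW r2)) ->.
have pi0N : rank_null r pi0 by split=> //; rewrite r0; case/andP: hr.
by apply: ne; rewrite !(power_fun_null_const hr phiU pi0N nr).
Qed.

(** Tables of rank 1 and of rank [r] show that null and alternative are both nonempty, so a strict
    inequality makes the power non-constant. *)
Lemma SUB_NTUB (R : realType) (p q r n : nat) (phi : count_table p q n -> R) :
  (2 <= r <= minn p q)%N ->
  SUB (@rank_null R p q r) phi -> NTUB (@rank_null R p q r) phi.
Proof.
move=> /andP[r2 rm] phiS; split=> [pi0 piA n0 nA|]; first exact/ltW/phiS.
have [|pi0 s0 r0] := @simplex_of_rank R p q 1; first by rewrite (leq_trans _ rm) // ltnW.
have [|piA sA rA] := @simplex_of_rank R p q r; first by rewrite rm (ltnW r2).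
exists pi0, piA; split=> //; apply/eqP; rewrite lt_eqF //; apply: phiS.
  by split; rewrite // r0.
by split=> // -[_]; rewrite rA ltnn.
Qed.

Theorem theorem7 (R : realType) (p q r : nat) (hr : (2 <= r <= minn p q)%N) :
  [/\ is_NTUB_threshold (@rank_null R p q r) (2 * r)%N,
      is_SUB_threshold (@rank_null R p q r) (2 * r)%N &
      forall alpha : R, 0 < alpha < 1 ->
        exists2 c : R, 0 < c &
          exists phi : count_table p q (2 * r)%N -> R,
            [/\ is_test phi,
                SUB (@rank_null R p q r) phi &
                forall pi : 'M[R]_(p, q), simplex pi ->
                  power_fun phi pi =
                    c * (\sum_(I : index_set p r) \sum_(J : index_set q r)
                           \det (square_submx pi I J) ^+ 2) + alpha]].
Proof.
have ex (alpha : R) : 0 < alpha < 1 -> exists2 c : R, 0 < c &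
    exists phi : count_table p q (2 * r)%N -> R,
    [/\ is_test phi, SUB (@rank_null R p q r) phi &
        forall pi, simplex pi -> power_fun phi pi = c * sum_minors r pi + alpha].
  move=> /(sum_minors_test p q r)[c c0 [phi [phiT phiE]]].
  exists c => //; exists phi; split=> // pi0 piA [s0 r0] [sA nA].
  rewrite !phiE // ltrD2r ltr_pM2l // sum_minors_eq0 // sum_minors_gt0 //.
  by rewrite leqNgt; apply/negP => ?; apply: nA.
(* Any level in the open unit interval would do; the resulting SUB test attains both thresholds. *)
have [|c _ [phi [phiT phiS _]]] := ex 2^-1; first by rewrite invr_gt0 ltr0n invf_lt1 ?ltr1n.
split=> [||//]; split; try by exists phi; split=> //; apply: SUB_NTUB.
- by move=> n [psi [_ psiN]]; apply: NTUB_sample_size psiN.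
- by move=> n [psi [_ psiS]]; apply: NTUB_sample_size (SUB_NTUB hr psiS).
Qed.
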